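(* Let $\mathcal{A}$ be a non-unital Banach algebra, let $\mathcal{A}^{\#}$ be its unitization, and let $n\in\mathbb{N}$. (i) If $\mathcal{A}^{\#}$ is approximately $2n$-weakly amenable, then $\mathcal{A}$ is approximately $2n$-weakly amenable. (ii) If $\mathcal{A}$ is approximately $(2n-1)$-weakly amenable, then $\mathcal{A}^{\#}$ is approximately $(2n-1)$-weakly amenable. (iii) Suppose that $\mathcal{A}$ is commutative. Then $\mathcal{A}^{\#}$ is approximately $n$-weakly amenable if and only if $\mathcal{A}$ is approximately $n$-weakly amenable. (iv) Suppose that $\mathcal{A}$ has a bounded approximate identity. Then $\mathcal{A}$ is approximately weakly amenable if and only if $\mathcal{A}^{\#}$ is approximately weakly amenable.
   Context: $\mathcal{A}^{\#}=\mathbb{C}e\oplus\mathcal{A}$ is the unitization of $\mathcal{A}$, with adjoined identity $e$. For a Banach algebra $\mathcal{C}$ and $k\ge 1$, $\mathcal{C}^{(k)}$ is the $k$-th conjugate (iterated dual) space of $\mathcal{C}$ ($\mathcal{C}^{(0)}=\mathcal{C}$). It is a Banach $\mathcal{C}$-bimodule with actions defined inductively by $\langle u,\Lambda\cdot a\rangle=\langle a\cdot u,\Lambda\rangle$ and $\langle u,a\cdot\Lambda\rangle=\langle u\cdot a,\Lambda\rangle$ for $\Lambda\in\mathcal{C}^{(k)}$, $u\in\mathcal{C}^{(k-1)}$, $a\in\mathcal{C}$. A derivation $D:\mathcal{C}\to\mathcal{X}$ into a Banach $\mathcal{C}$-bimodule is a linear map with $D(ab)=a\cdot D(b)+D(a)\cdot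 b$. It is approximately inner if there is a net $(x_\alpha)\subseteq\mathcal{X}$ (not required to be bounded) with $D(a)=\lim_\alpha(a\cdot x_\alpha-x_\alpha\cdot a)$ in norm for every $a\in\mathcal{C}$. $\mathcal{C}$ is approximately $k$-weakly amenable if every continuous derivation $\mathcal{C}\to\mathcal{C}^{(k)}$ is approximately inner. Approximately weakly amenable means approximately $1$-weakly amenable. *)

(* Defs.v *)
From HB Require Import structures.
From mathcomp Require Import all_boot all_order all_algebra.
From mathcomp Require Import complex.
From mathcomp Require Import boolp classical_sets functions reals.
From mathcomp Require Import topology normedtype.

Set Implicit Arguments.
Unset Strict Implicit.
Unset Printing Implicit Defensive.

Import Order.TTheory GRing.Theory Num.Theory.
Import numFieldNormedType.Exports.

Local Open Scope classical_set_scope.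
Local Open Scope ring_scope.
Local Open Scope complex_scope.

Section complex_complete.
Variable R : realType.

Lemma complex_ReB (z w : R[i]) :
  complex.Re (z - w) = complex.Re z - complex.Re w.
Proof. by case: z; case: w. Qed.

Lemma complex_ImB (z w : R[i]) :
  complex.Im (z - w) = complex.Im z - complex.Im w.
Proof. by case: z; case: w. Qed.

Lemma normc_ge_Re (z : R[i]) : `|complex.Re z|%:C <= `|z|.
Proof.
rewrite normc_def lecR -sqrtr_sqr ler_sqrt ?lerDl ?sqr_ge0//.
by rewrite addr_ge0 ?sqr_ge0.
Qed.

Lemma normc_ge_Im (z : R[i]) : `|complex.Im z|%:C <= `|z|.
Proof.
rewrite normc_def lecR -sqrtr_sqr ler_sqrt ?lerDr ?sqr_ge0//.
by rewrite addr_ge0 ?sqr_ge0.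
Qed.

Lemma normc_le_ReIm (z : R[i]) :
  `|z| <= (`|complex.Re z| + `|complex.Im z|)%:C.
Proof.
rewrite normc_def lecR -ler_sqr ?nnegrE ?sqrtr_ge0 ?addr_ge0//.
rewrite sqr_sqrtr ?addr_ge0 ?sqr_ge0// sqrrD !real_normK ?num_real//.
by rewrite lerD2r lerDl mulrn_wge0// mulr_ge0.
Qed.

Lemma complex_complete (F : set_system R[i]^o) :
  ProperFilter F -> cauchy F -> cvg F.
Proof.
move=> FF Fc.
have Re_cvg (p : R[i] -> R) : (forall z w, p (z - w) = p z - p w) ->
    (forall z, `|p z|%:C <= `|z|) -> exists l : R, p @ F --> l.
  move=> pB ple; apply/cvg_ex; apply: cauchy_cvg; apply/cauchyP => e e0.
  have eC : (0 : R[i]) < e%:C by rewrite ltcR.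
  have [z Fz] := (cauchyP F).1 Fc _ eC.
  exists (p z); rewrite /fmap/=; move: Fz; apply: filterS => w.
  rewrite -ball_normE /= => zw; rewrite -ball_normE /= -pB -ltcR.
  exact: le_lt_trans zw.
have [a pa] := Re_cvg (@complex.Re R) complex_ReB normc_ge_Re.
have [b pb] := Re_cvg (@complex.Im R) complex_ImB normc_ge_Im.
apply/cvg_ex; exists (a +i* b); apply/cvgrPdist_le => e e0.
have eE : e = (complex.Re e)%:C by rewrite RRe_real// gtr0_real.
have r0 : 0 < complex.Re e / 2 by rewrite divr_gt0// -ltcR -eE.
move/cvgrPdist_le : pa => /(_ _ r0) pa.
move/cvgrPdist_le : pb => /(_ _ r0) pb.
near=> z; rewrite (le_trans (normc_le_ReIm _))// eE lecR.
by rewrite complex_ReB complex_ImB [leRHS]splitr lerD//; near: z.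
Unshelve. all: by end_near. Qed.

End complex_complete.

Section dual.
Variables (R : realType) (V : normedModType R[i]).

Definition dual_pred : {pred V -> R[i]^o} :=
  [pred f : V -> R[i]^o | `[< linear f /\ continuous f >]].

Record dual := Dual { dual_fun :> V -> R[i]^o; _ : dual_fun \in dual_pred }.

HB.instance Definition _ := [isSub for dual_fun].
HB.instance Definition _ := [Choice of dual by <:].

Lemma dual_predP (f : V -> R[i]^o) :
  reflect (linear f /\ continuous f) (f \in dual_pred).
Proof. exact: asboolP. Qed.

Lemma dual_pred_submod : submod_closed dual_pred.
Proof.
split=> [|a f g /dual_predP[flin fcont] /dual_predP[glin gcont]];
  apply/dual_predP; split.
- by move=> a x y; rewrite /= scaler0 addr0.
- by move=> x; exact: cvg_cst.
- move=> b x y; rewrite !fctE flin glin !scalerDr !scalerA [a * b]mulrC.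
  by rewrite addrACA.
- by move=> x; apply: cvgD; [apply: cvgZr; exact: fcont|exact: gcont].
Qed.
HB.instance Definition _ :=
  GRing.isSubmodClosed.Build R[i] (V -> R[i]^o) dual_pred dual_pred_submod.
HB.instance Definition _ := [SubChoice_isSubLmodule of dual by <:].

Lemma dual_linear (f : dual) : linear f.
Proof. by have /dual_predP[] := valP f. Qed.

Lemma dual_continuous (f : dual) : continuous f.
Proof. by have /dual_predP[] := valP f. Qed.

HB.instance Definition _ (f : dual) :=
  GRing.isLinear.Build R[i] V R[i]^o _ (dual_fun f) (dual_linear f).

Lemma dual_ext (f g : dual) : f =1 g -> f = g.
Proof. by move=> fg; apply/val_inj/funext. Qed.

Lemma dualDE (f g : dual) x : (f + g) x = f x + g x. Proof. by []. Qed.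

Lemma dualBE (f g : dual) x : (f - g) x = f x - g x. Proof. by []. Qed.

Lemma dualZE a (f : dual) x : (a *: f) x = a * f x. Proof. by []. Qed.

Lemma dual0E x : (0 : dual) x = 0. Proof. by []. Qed.

Lemma dual_bounded (f : dual) :
  exists2 M : R[i], 0 <= M & forall x, `|f x| <= M * `|x|.
Proof.
have /linear_boundedP/pinfty_ex_gt0[M M0 fM] :=
  (linear_bounded_continuous f).2 (@dual_continuous f).
by exists M => //; exact: ltW.
Qed.

Lemma bounded_dual (f : V -> R[i]^o) (M : R[i]) :
  linear f -> 0 <= M -> (forall x, `|f x| <= M * `|x|) -> f \in dual_pred.
Proof.
move=> flin M0 fM; apply/dual_predP; split=> //.
pose Lf := GRing.isLinear.Build R[i] V R[i]^o _ f flin.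
pose g : {linear V -> R[i]^o} := HB.pack f Lf.
apply: (@bounded_linear_continuous _ _ _ g); apply/linear_boundedP.
near=> r => x; rewrite (le_trans (fM x))// ler_wpM2r//.
by near: r; apply: nbhs_pinfty_ge; exact: ger0_real.
Unshelve. all: by end_near. Qed.

(* [`|z|] lives in [R[i]], where suprema are not available; the supremum is
   taken over the real parts. *)
Definition dual_norm (f : dual) : R[i] :=
  (sup [set complex.Re `|f x| | x in [set x : V | `|x| <= 1]])%:C.

Let ball_img (f : dual) := [set complex.Re `|f x| | x in [set x : V | `|x| <= 1]].

Let normE (z : R[i]) : `|z| = (complex.Re `|z|)%:C.
Proof. by rewrite RRe_real// normr_real. Qed.

Lemma dual_norm_has_sup (f : dual) : has_sup (ball_img f).
Proof.
split; first by exists (complex.Re `|f 0|), 0 => //=; rewrite normr0 ler01.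
have [M M0 fM] := dual_bounded f.
exists (complex.Re M) => _ [x /= x1 <-]; rewrite -lecR -normE RRe_real ?ger0_real//.
by rewrite (le_trans (fM x))// ler_piMr.
Qed.

Lemma dual_norm_ge0 (f : dual) : 0 <= dual_norm f.
Proof.
rewrite lecR; apply: (@le_trans _ _ (complex.Re `|f 0|)).
  by rewrite -ler0c -normE.
apply: sup_ubound; first by case: (dual_norm_has_sup f).
by exists 0 => //=; rewrite normr0 ler01.
Qed.

Lemma dual_normP (f : dual) x : `|f x| <= dual_norm f * `|x|.
Proof.
have [->|x0] := eqVneq x 0; first by rewrite raddf0 !normr0 mulr0.
have nx0 : 0 < `|x| by rewrite normr_gt0.
rewrite -ler_pdivrMr//.
have -> : `|f x| / `|x| = `|f (`|x|^-1 *: x)|.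
  by rewrite linearZ/= normrM normfV normr_id mulrC.
rewrite normE lecR; apply: sup_ubound; first by case: (dual_norm_has_sup f).
by exists (`|x|^-1 *: x) => //=; rewrite normrZ normfV normr_id mulVf ?gt_eqF.
Qed.

Lemma dual_norm_le (f : dual) (M : R[i]) :
  0 <= M -> (forall x, `|f x| <= M * `|x|) -> dual_norm f <= M.
Proof.
move=> M0 fM; rewrite -[M]RRe_real ?ger0_real// lecR.
apply: ge_sup; first by case: (dual_norm_has_sup f).
move=> _ [x /= x1 <-]; rewrite -lecR -normE RRe_real ?ger0_real//.
by rewrite (le_trans (fM x))// ler_piMr.
Qed.

Lemma dual_normD (f g : dual) : dual_norm (f + g) <= dual_norm f + dual_norm g.
Proof.
apply: dual_norm_le => [|x]; first by rewrite addr_ge0 ?dual_norm_ge0.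
by rewrite mulrDl (le_trans (ler_normD _ _))// lerD ?dual_normP.
Qed.

Lemma dual_normZ (a : R[i]) (f : dual) : dual_norm (a *: f) = `|a| * dual_norm f.
Proof.
have le_normZ b g : dual_norm (b *: g) <= `|b| * dual_norm g.
  apply: dual_norm_le => [|x]; first by rewrite mulr_ge0 ?dual_norm_ge0.
  by rewrite dualZE normrM -mulrA ler_wpM2l ?dual_normP.
apply/le_anti; rewrite le_normZ/=.
have [->|a0] := eqVneq a 0; first by rewrite normr0 mul0r dual_norm_ge0.
rewrite -ler_pdivlMl ?normr_gt0// -normfV.
by rewrite (le_trans _ (le_normZ _ _))// scalerA mulVf// scale1r.
Qed.

Lemma dual_norm_eq0 (f : dual) : dual_norm f = 0 -> f = 0.
Proof.
move=> f0; apply: dual_ext => x; apply/eqP; rewrite -normr_le0.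
by rewrite (le_trans (dual_normP _ _))// f0 mul0r.
Qed.

HB.instance Definition _ :=
  Lmodule_isNormed.Build R[i] dual dual_normD dual_normZ dual_norm_eq0.

Lemma dual_leP (f : dual) x : `|f x| <= `|f| * `|x|.
Proof. exact: dual_normP. Qed.

Lemma dual_le (f : dual) (M : R[i]) :
  0 <= M -> (forall x, `|f x| <= M * `|x|) -> `|f| <= M.
Proof. exact: dual_norm_le. Qed.

Lemma dual_complete (F : set_system dual) :
  ProperFilter F -> cauchy F -> cvg F.
Proof.
move=> FF Fc.
have F_ex e : 0 < e -> exists f0 : dual, \forall f \near F, `|f0 - f| < e.
  move=> /((cauchyP F).1 Fc)[f0 Ff0]; exists f0.
  by move: Ff0; apply: filterS => f; rewrite -ball_normE.
have F_cvg x : exists l : R[i]^o, (fun f : dual => f x) @ F --> l.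
  apply/cvg_ex; apply: complex_complete; apply/cauchyP => e e0.
  have d0 : 0 < e / (`|x| + 1) by rewrite divr_gt0// ltr_wpDl.
  have [f0 Ff0] := F_ex _ d0.
  exists (f0 x); rewrite /fmap/=; move: Ff0; apply: filterS => f.
  rewrite ltr_pdivlMr ?ltr_wpDl// -ball_normE /= -dualBE; apply: le_lt_trans.
  by rewrite (le_trans (dual_leP _ _))// ler_wpM2l// lerDl.
pose l x := projT1 (cid (F_cvg x)).
have lP x : (fun f : dual => f x) @ F --> l x by rewrite /l; case: cid.
have llin : linear l.
  move=> a x y; apply: (@cvg_unique _ (@norm_hausdorff _ R[i]^o) _ _ _ _ (lP _)).
  have -> : (fun f : dual => f (a *: x + y)) = (fun f : dual => a *: (f x : R[i]^o) + f y).
    by apply/funext => f; rewrite linearP.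
  by apply: cvgD; [apply: cvgZr; exact: lP|exact: lP].
have l_le (f0 : dual) e : 0 < e -> (\forall f \near F, `|f0 - f| < e) ->
    forall x, `|f0 x - l x| <= e * `|x|.
  move=> e0 Ff0 x.
  apply/ler_addgt0Pr => d d0; near F => f.
  rewrite (le_trans (ler_distD (f x) _ _))// lerD//.
    rewrite -dualBE (le_trans (dual_leP _ _))// ler_wpM2r// ltW//.
    by near: f.
  by rewrite distrC; near: f; move/cvgrPdist_le : (lP x); exact.
have [f0 Ff0] := F_ex 1 ltr01.
have lD : l \in dual_pred.
  apply: (@bounded_dual _ (1 + `|f0|)) => // [|x]; first by rewrite addr_ge0.
  rewrite mulrDl -[l x](subrK (f0 x)) (le_trans (ler_normD _ _))// lerD ?dual_leP//.
  by rewrite distrC l_le.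
apply/cvg_ex; exists (Dual lD); apply/cvgrPdist_le => e e0.
have e20 : 0 < e / 2 by rewrite divr_gt0.
have [f1 Ff1] := F_ex _ e20.
move: (Ff1); apply: filterS => f f1f.
rewrite [leRHS]splitr (le_trans (ler_distD f1 _ _))// lerD ?(ltW f1f)//.
apply: dual_le => [|x]; first exact: ltW.
by rewrite dualBE distrC l_le.
Unshelve. all: by end_near. Qed.

HB.instance Definition _ := Uniform_isComplete.Build dual dual_complete.

End dual.

(* MathComp rings have a unit, so the product of a possibly non-unital Banach
   algebra is declared on top of the normed space. *)
HB.mixin Record isBanachAlgebra (K : numFieldType) A
    & CompleteNormedModule K A := {
  bmul : A -> A -> A;
  bmulA : associative bmul;
  bmul_linearl : forall b, linear (bmul^~ b);
  bmul_linearr : forall a, linear (bmul a);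
  bmul_norm : forall a b, `|bmul a b| <= `|a| * `|b|
}.

#[short(type="banachAlgType")]
HB.structure Definition BanachAlgebra (K : numFieldType) :=
  {A of CompleteNormedModule K A & isBanachAlgebra K A}.

Record banach_bimodule (K : numFieldType) (A : banachAlgType K) := BanachBimodule {
  bimod_sort :> completeNormedModType K;
  lact : A -> bimod_sort -> bimod_sort;
  ract : bimod_sort -> A -> bimod_sort;
  lact_linearl : forall x, linear (lact^~ x);
  lact_linearr : forall a, linear (lact a);
  ract_linearl : forall a, linear (ract^~ a);
  ract_linearr : forall x, linear (ract x);
  lactM : forall a b x, lact (bmul a b) x = lact a (lact b x);
  ractM : forall x a b, ract x (bmul a b) = ract (ract x a) b;
  lractA : forall a x b, ract (lact a x) b = lact a (ract x b);
  act_bounded : exists2 M, 0 <= M & forall a x,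
    `|lact a x| <= M * `|a| * `|x| /\ `|ract x a| <= M * `|a| * `|x|
}.

Section regular_bimodule.
Variables (K : numFieldType) (A : banachAlgType K).

Lemma regular_bounded : exists2 M : K, 0 <= M & forall a x : A,
  `|bmul a x| <= M * `|a| * `|x| /\ `|bmul x a| <= M * `|a| * `|x|.
Proof.
exists 1 => // a x; rewrite mul1r; split; first exact: bmul_norm.
by rewrite mulrC; exact: bmul_norm.
Qed.

Definition regular_bimodule : banach_bimodule A :=
  @BanachBimodule K A A (@bmul K A) (@bmul K A)
    (@bmul_linearl K A) (@bmul_linearr K A) (@bmul_linearl K A) (@bmul_linearr K A)
    (fun a b x => esym (bmulA a b x)) (fun x a b => bmulA x a b)
    (fun a x b => esym (bmulA a x b)) regular_bounded.

End regular_bimodule.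

Section dual_bimodule.
Variables (R : realType) (A : banachAlgType R[i]) (X : banach_bimodule A).

(* <u, a . f> = <u . a, f> and <u, f . a> = <a . u, f> *)
Definition dual_lact_fun (a : A) (f : dual X) (u : X) : R[i]^o := f (ract u a).
Definition dual_ract_fun (f : dual X) (a : A) (u : X) : R[i]^o := f (lact a u).

Lemma dual_lact_le a f M : (forall a (x : X), `|ract x a| <= M * `|a| * `|x|) ->
  forall u, `|dual_lact_fun a f u| <= M * `|a| * `|f| * `|u|.
Proof.
move=> rM u; rewrite (le_trans (dual_leP _ _))//.
by rewrite [M * _ * _]mulrC -mulrA ler_wpM2l.
Qed.

Lemma dual_ract_le f a M : (forall a (x : X), `|lact a x| <= M * `|a| * `|x|) ->
  forall u, `|dual_ract_fun f a u| <= M * `|a| * `|f| * `|u|.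
Proof.
move=> rM u; rewrite (le_trans (dual_leP _ _))//.
by rewrite [M * _ * _]mulrC -mulrA ler_wpM2l.
Qed.

Lemma dual_lact_subproof a f : dual_lact_fun a f \in @dual_pred R X.
Proof.
have [M M0 XM] := act_bounded X.
apply: (@bounded_dual _ _ _ (M * `|a| * `|f|)); last first.
- by apply: dual_lact_le => b x; case: (XM b x).
- by rewrite !mulr_ge0.
- by move=> c u v; rewrite /dual_lact_fun ract_linearl linearP.
Qed.
Definition dual_lact a f : dual X := Dual (dual_lact_subproof a f).

Lemma dual_ract_subproof f a : dual_ract_fun f a \in @dual_pred R X.
Proof.
have [M M0 XM] := act_bounded X.
apply: (@bounded_dual _ _ _ (M * `|a| * `|f|)); last first.
- by apply: dual_ract_le => b x; case: (XM b x).
- by rewrite !mulr_ge0.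
- by move=> c u v; rewrite /dual_ract_fun lact_linearr linearP.
Qed.
Definition dual_ract f a : dual X := Dual (dual_ract_subproof f a).

Lemma dual_lact_linearl f : linear (dual_lact^~ f).
Proof.
by move=> c a b; apply: dual_ext => u /=; rewrite /dual_lact_fun ract_linearr linearP.
Qed.

Lemma dual_lact_linearr a : linear (dual_lact a).
Proof. by move=> c f g; apply: dual_ext => u. Qed.

Lemma dual_ract_linearl a : linear (dual_ract^~ a).
Proof. by move=> c f g; apply: dual_ext => u. Qed.

Lemma dual_ract_linearr f : linear (dual_ract f).
Proof.
by move=> c a b; apply: dual_ext => u /=; rewrite /dual_ract_fun lact_linearl linearP.
Qed.

Lemma dual_lactM a b f : dual_lact (bmul a b) f = dual_lact a (dual_lact b f).
Proof. by apply: dual_ext => u /=; rewrite /dual_lact_fun ractM. Qed.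

Lemma dual_ractM f a b : dual_ract f (bmul a b) = dual_ract (dual_ract f a) b.
Proof. by apply: dual_ext => u /=; rewrite /dual_ract_fun lactM. Qed.

Lemma dual_lractA a f b :
  dual_ract (dual_lact a f) b = dual_lact a (dual_ract f b).
Proof.
by apply: dual_ext => u /=; rewrite /dual_ract_fun /= /dual_lact_fun /= lractA.
Qed.

Lemma dual_act_bounded : exists2 M : R[i], 0 <= M & forall a f,
  `|dual_lact a f| <= M * `|a| * `|f| /\ `|dual_ract f a| <= M * `|a| * `|f|.
Proof.
have [M M0 XM] := act_bounded X; exists M => // a f.
by split; apply: dual_le; rewrite ?mulr_ge0//;
  [apply: dual_lact_le|apply: dual_ract_le] => b x; case: (XM b x).
Qed.

Definition dual_bimodule : banach_bimodule A :=
  BanachBimodule dual_lact_linearl dual_lact_linearr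
    dual_ract_linearl dual_ract_linearr dual_lactM dual_ractM dual_lractA
    dual_act_bounded.

End dual_bimodule.

Fixpoint iter_dual (R : realType) (A : banachAlgType R[i]) (k : nat) :
    banach_bimodule A :=
  if k is k'.+1 then dual_bimodule (iter_dual A k') else regular_bimodule A.

Section net.
Variables (I : Type) (le : I -> I -> Prop).

Definition directed : Prop :=
  [/\ inhabited I, forall i, le i i,
      forall i j k, le i j -> le j k -> le i k &
      forall i j, exists k, le i k /\ le j k].

Definition net_tails : set_system I :=
  [set P | exists i, forall j, le i j -> P j].

End net.

Section amenability.
Variables (R : realType) (A : banachAlgType R[i]).

Definition derivation (X : banach_bimodule A) (D : A -> X) : Prop :=
  linear D /\ forall a b, D (bmul a b) = lact a (D b) + ract (D a) b.

Definition approximately_inner (X : banach_bimodule A) (D : A -> X) : Prop :=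
  exists (I : Type) (le : I -> I -> Prop) (x : I -> X), directed le /\
    forall a, (fun i => lact a (x i) - ract (x i) a) @ net_tails le --> D a.

Definition approximately_k_weakly_amenable (k : nat) : Prop :=
  forall D : A -> iter_dual A k,
    derivation D -> continuous D -> approximately_inner D.

Definition approximately_weakly_amenable : Prop :=
  approximately_k_weakly_amenable 1.

Definition has_identity : Prop :=
  exists e : A, forall a, bmul e a = a /\ bmul a e = a.

Definition has_bounded_approximate_identity : Prop :=
  exists (I : Type) (le : I -> I -> Prop) (e : I -> A),
    [/\ directed le, exists M, forall i, `|e i| <= M &
        forall a, (fun i => bmul (e i) a) @ net_tails le --> a /\
                  (fun i => bmul a (e i)) @ net_tails le --> a].

End amenability.

(* The pair (a, z) stands for z e + a, normed by |a| + |z|; the type synonym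
   avoids the maximum norm that MathComp-Analysis puts on products. *)
Definition unitization (R : realType) (A : banachAlgType R[i]) : Type :=
  (A * R[i]^o)%type.

Section unitization.
Variables (R : realType) (A : banachAlgType R[i]).

HB.instance Definition _ := GRing.Lmodule.copy (unitization A) (A * R[i]^o)%type.

Definition unitization_norm (x : unitization A) : R[i] := `|x.1| + `|x.2|.

Lemma unitization_normD (x y : unitization A) :
  unitization_norm (x + y) <= unitization_norm x + unitization_norm y.
Proof. by rewrite /unitization_norm addrACA lerD// ler_normD. Qed.

Lemma unitization_normZ (c : R[i]) (x : unitization A) :
  unitization_norm (c *: x) = `|c| * unitization_norm x.
Proof. by rewrite /unitization_norm mulrDr !normrZ. Qed.

Lemma unitization_norm_eq0 (x : unitization A) : unitization_norm x = 0 -> x = 0.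
Proof.
case: x => a z /eqP; rewrite paddr_eq0// !normr_eq0 /=.
by move=> /andP[/eqP-> /eqP->].
Qed.

HB.instance Definition _ := Lmodule_isNormed.Build R[i] (unitization A)
  unitization_normD unitization_normZ unitization_norm_eq0.

Lemma unitization_normE (x : unitization A) : `|x| = `|x.1| + `|x.2|.
Proof. by []. Qed.

Lemma unitization_complete (F : set_system (unitization A)) :
  ProperFilter F -> cauchy F -> cvg F.
Proof.
move=> FF Fc.
have F_ex e : 0 < e -> exists x0 : unitization A, \forall x \near F, `|x0 - x| < e.
  move=> /((cauchyP F).1 Fc)[x0 Fx0]; exists x0.
  by move: Fx0; apply: filterS => x; rewrite -ball_normE.
have [a Fa] : exists a : A, (fun x : unitization A => x.1) @ F --> a.
  apply/cvg_ex; apply: cauchy_cvg; apply/cauchyP => e /F_ex[x0 Fx0].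
  exists x0.1; rewrite /fmap/=; move: Fx0; apply: filterS => x.
  by rewrite -ball_normE /=; apply: le_lt_trans; rewrite unitization_normE lerDl.
have [z Fz] : exists z : R[i]^o, (fun x : unitization A => x.2) @ F --> z.
  apply/cvg_ex; apply: complex_complete; apply/cauchyP => e /F_ex[x0 Fx0].
  exists x0.2; rewrite /fmap/=; move: Fx0; apply: filterS => x.
  by rewrite -ball_normE /=; apply: le_lt_trans; rewrite unitization_normE lerDr.
apply/cvg_ex; exists ((a, z) : unitization A); apply/cvgrPdist_le => e e0.
have e20 : 0 < e / 2 by rewrite divr_gt0.
move/cvgrPdist_le : Fa => /(_ _ e20) Fa.
move/cvgrPdist_le : Fz => /(_ _ e20) Fz.
near=> x; rewrite unitization_normE [leRHS]splitr lerD//.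
  by near: x.
by near: x.
Unshelve. all: by end_near. Qed.

HB.instance Definition _ :=
  Uniform_isComplete.Build (unitization A) unitization_complete.

Definition unitization_mul (x y : unitization A) : unitization A :=
  (bmul x.1 y.1 + y.2 *: x.1 + x.2 *: y.1, x.2 * y.2).

Lemma unitization_mulA : associative unitization_mul.
Proof.
have DL (b : A) : {morph (@bmul _ A)^~ b : x y / x + y}.
  by move=> x y; have := bmul_linearl b 1 x y; rewrite !scale1r.
have DR (b : A) : {morph (@bmul _ A) b : x y / x + y}.
  by move=> x y; have := bmul_linearr b 1 x y; rewrite !scale1r.
have L0 (b : A) : bmul 0 b = 0 by apply: (addrI (bmul 0 b)); rewrite -DL !addr0.
have R0 (b : A) : bmul b 0 = 0 by apply: (addrI (bmul b 0)); rewrite -DR !addr0.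
have ZL (b : A) c x : bmul (c *: x) b = c *: bmul x b.
  by have := bmul_linearl b c x 0; rewrite L0 !addr0.
have ZR (b : A) c x : bmul b (c *: x) = c *: bmul b x.
  by have := bmul_linearr b c x 0; rewrite R0 !addr0.
move=> [a s] [b t] [c u]; rewrite /unitization_mul /=; congr pair.
  rewrite !DL !DR !ZL !ZR bmulA !scalerDr !scalerA [u * t]mulrC [u * s]mulrC.
  rewrite -!addrA; congr (_ + _).
  by rewrite [RHS](AC (1*(1*(1*(1*1)))) (3*(1*(4*(2*5))))).
exact: mulrA.
Qed.

Lemma unitization_mul_linearl y : linear (unitization_mul^~ y).
Proof.
move=> c [a s] [b t]; case: y => d u; rewrite /unitization_mul /=.
congr pair => /=; last by rewrite mulrDl -scalerAl.
rewrite bmul_linearl !scalerDr scalerDl !scalerA [u * c]mulrC.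
by rewrite [LHS](AC (2*2*2) ((1*3*5)*(2*4*6))).
Qed.

Lemma unitization_mul_linearr x : linear (unitization_mul x).
Proof.
move=> c [a s] [b t]; case: x => d u; rewrite /unitization_mul /=.
congr pair => /=; last by rewrite mulrDr -scalerAr.
rewrite bmul_linearr !scalerDr scalerDl !scalerA [u * c]mulrC.
by rewrite [LHS](AC (2*2*2) ((1*3*5)*(2*4*6))).
Qed.

Lemma unitization_mul_norm x y : `|unitization_mul x y| <= `|x| * `|y|.
Proof.
rewrite !unitization_normE /= normrM !mulrDl !mulrDr addrA lerD2r.
rewrite (le_trans (ler_normD _ _))// normrZ lerD2r.
rewrite (le_trans (ler_normD _ _))// normrZ [`|y.2| * _]mulrC lerD2r.
exact: bmul_norm.
Qed.

HB.instance Definition _ := isBanachAlgebra.Build R[i] (unitization A)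
  unitization_mulA unitization_mul_linearl unitization_mul_linearr
  unitization_mul_norm.

Lemma unitization_has_identity : has_identity (unitization A).
Proof.
have L0 (b : A) : bmul 0 b = 0.
  by have := bmul_linearl b (-1) 0 0; rewrite !scaleN1r !addNr.
have R0 (b : A) : bmul b 0 = 0.
  by have := bmul_linearr b (-1) 0 0; rewrite !scaleN1r !addNr.
exists ((0, 1) : unitization A) => -[a z].
split; congr pair => /=; rewrite ?mul1r ?mulr1//.
  by rewrite L0 scaler0 scale1r !add0r.
by rewrite R0 scaler0 scale1r add0r addr0.
Qed.

End unitization.

(* Main.v *)
Require Import Defs.
From HB Require Import structures.
From mathcomp Require Import all_boot all_order all_algebra.
From mathcomp Require Import complex.
From mathcomp Require Import boolp classical_sets reals topology normedtype.

(* Write B for the unitization of A. Transposing the inclusion A -> B and the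
   projection B -> A repeatedly gives B^(k) = A^(k) + C, the second summand being
   spanned by the identity e for even k and by the character eps : B -> C for odd k.
   Both coordinate maps commute with the inner derivations of A, so derivations can
   be moved between A^(k) and B^(k); only the scalar component d of a derivation
   of B has to be controlled.
   - k odd: d kills products, and then a |-> d(a) d is a derivation of A, so that
     d(a)^2 = lim <a, a.x - x.a> = 0.
   - A commutative: approximately inner derivations vanish, and one applies this to
     the derivations c.D, which take values in the summand A^(k) for k even and
     extend to B for k odd.
   - A with a bounded approximate identity (e_i): d(a) = lim <e_i, D a> extends a
     derivation D : A -> A^* to B. *)

Import Order.TTheory GRing.Theory Num.Theory.
Import numFieldNormedType.Exports.

Local Open Scope classical_set_scope.
Local Open Scope ring_scope.
Local Open Scope complex_scope.

Set Implicit Arguments.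
Unset Strict Implicit.
Unset Printing Implicit Defensive.

(** * Bounded linear maps and their adjoints *)

Section bounded_linear_maps.
Variable R : realType.
Implicit Types U V W : normedModType R[i].

Record blin V W := Blin {
  blin_fun :> V -> W;
  blin_linear : linear blin_fun;
  blin_continuous : continuous blin_fun
}.

HB.instance Definition _ V W (T : blin V W) :=
  GRing.isLinear.Build R[i] V W _ (blin_fun T) (blin_linear T).

Lemma blinD V W (T : blin V W) x y : T (x + y) = T x + T y.
Proof. exact: raddfD. Qed.

Lemma blinZ V W (T : blin V W) (z : R[i]) x : T (z *: x) = z *: T x.
Proof. by rewrite linearZ. Qed.

Lemma linear_bound_continuous V W (f : V -> W) (M : R[i]) :
  linear f -> 0 <= M -> (forall x, `|f x| <= M * `|x|) -> continuous f.
Proof.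
move=> flin M0 fM.
pose g : {linear V -> W} := HB.pack f (GRing.isLinear.Build R[i] V W _ f flin).
apply: (@bounded_linear_continuous _ _ _ g); apply/linear_boundedP.
near=> r => x; rewrite (le_trans (fM x))// ler_wpM2r//.
by near: r; apply: nbhs_pinfty_ge; exact: ger0_real.
Unshelve. all: by end_near. Qed.

Lemma blin_bounded V W (T : blin V W) :
  exists2 M : R[i], 0 <= M & forall x, `|T x| <= M * `|x|.
Proof.
have /linear_boundedP/pinfty_ex_gt0[M M0 TM] :=
  (linear_bounded_continuous T).2 (@blin_continuous _ _ T).
by exists M => //; exact: ltW.
Qed.

Lemma blin_comp_linear U V W (S : blin V W) (T : blin U V) : linear (S \o T).
Proof. by move=> a x y; rewrite /= !linearP. Qed.

Lemma blin_comp_continuous U V W (S : blin V W) (T : blin U V) :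
  continuous (S \o T).
Proof.
by move=> x; apply: continuous_comp; exact: blin_continuous.
Qed.

Definition blin_comp U V W (S : blin V W) (T : blin U V) : blin U W :=
  Blin (blin_comp_linear S T) (@blin_comp_continuous _ _ _ S T).

(** Rank-one maps give the test derivations [a |-> f(a) w] that force a functional [f] to vanish. *)
Lemma rank_one_linear V W (f : dual V) (w : W) : linear (fun x => (f x : R[i]) *: w).
Proof. by move=> a x y; rewrite linearP scalerDl scalerA. Qed.

Lemma rank_one_continuous V W (f : dual V) (w : W) :
  continuous (fun x => (f x : R[i]) *: w).
Proof.
apply: (@linear_bound_continuous _ _ _ (`|f| * `|w|)).
- exact: rank_one_linear.
- exact: mulr_ge0.
- by move=> x; rewrite normrZ mulrAC ler_wpM2r// dual_leP.
Qed.

Definition rank_one V W (f : dual V) (w : W) : blin V W :=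
  Blin (rank_one_linear f w) (@rank_one_continuous _ _ f w).

Lemma dual_comp_subproof V W (T : blin V W) (f : dual W) :
  (f \o T : V -> R[i]^o) \in @dual_pred R V.
Proof.
apply/dual_predP; split; first by move=> a x y; rewrite /= !linearP.
by move=> x; apply: continuous_comp; [exact: blin_continuous|exact: dual_continuous].
Qed.

Definition dual_comp V W (T : blin V W) (f : dual W) : dual V :=
  Dual (dual_comp_subproof T f).

Lemma dual_comp_linear V W (T : blin V W) : linear (dual_comp T).
Proof. by move=> a f g; apply: dual_ext. Qed.

Lemma dual_comp_continuous V W (T : blin V W) : continuous (dual_comp T).
Proof.
have [M M0 TM] := blin_bounded T.
apply: (@linear_bound_continuous _ _ _ M) => //; first exact: dual_comp_linear.
move=> f; apply: dual_le => [|x]; first exact: mulr_ge0.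
by rewrite (le_trans (dual_leP f (T x)))// [M * _]mulrC -mulrA ler_wpM2l.
Qed.

Definition adjoint V W (T : blin V W) : blin (dual W) (dual V) :=
  Blin (@dual_comp_linear _ _ T) (@dual_comp_continuous _ _ T).

Lemma evaluation_subproof V (x : V) :
  (fun f : dual V => f x) \in @dual_pred R (dual V).
Proof.
by apply: (@bounded_dual _ _ _ `|x|) => // f; rewrite mulrC dual_leP.
Qed.

Definition evaluation V (x : V) : dual (dual V) := Dual (evaluation_subproof x).

End bounded_linear_maps.

Lemma net_tails_proper (I : Type) (le : I -> I -> Prop) :
  directed le -> ProperFilter (net_tails le).
Proof.
move=> le_directed; have [[i0] le_refl le_trans le_sup] := le_directed.
split; last first.
  split.
  - by exists i0.
  - move=> P Q [i Pi] [j Qj]; have [k [ik jk]] := le_sup i j.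
    exists k => l kl; split; first by apply: Pi; exact: le_trans kl.
    by apply: Qj; exact: le_trans kl.
  - by move=> P Q PQ [i Pi]; exists i => j /Pi /PQ.
by move=> [i /(_ i (le_refl i))].
Qed.

(** * Module actions, the pairing of consecutive duals, and canonical embeddings *)

Section bimodules.
Variables (R : realType) (A : banachAlgType R[i]).
Implicit Types (X : banach_bimodule A) (a b : A).

HB.instance Definition _ X a :=
  GRing.isLinear.Build R[i] X X _ (@lact _ _ X a) (@lact_linearr _ _ X a).

Lemma lactDl X a b (x : X) : lact (a + b) x = lact a x + lact b x.
Proof. by have := lact_linearl x 1 a b; rewrite !scale1r. Qed.

Lemma lact0l X (x : X) : lact 0 x = 0.
Proof. by have := lact_linearl x (-1) 0 0; rewrite !scaleN1r !addNr. Qed.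

Lemma lactZl X (c : R[i]) a (x : X) : lact (c *: a) x = c *: lact a x.
Proof. by have := lact_linearl x c a 0; rewrite lact0l !addr0. Qed.

Lemma lactDr X a (x y : X) : lact a (x + y) = lact a x + lact a y.
Proof. by rewrite linearD. Qed.

Lemma lactZr X (c : R[i]) a (x : X) : lact a (c *: x) = c *: lact a x.
Proof. by rewrite linearZ. Qed.

Lemma ractDr X a b (x : X) : ract x (a + b) = ract x a + ract x b.
Proof. by have := ract_linearr x 1 a b; rewrite !scale1r. Qed.

Lemma ract0r X (x : X) : ract x 0 = 0.
Proof. by have := ract_linearr x (-1) 0 0; rewrite !scaleN1r !addNr. Qed.

Lemma ractZr X (c : R[i]) a (x : X) : ract x (c *: a) = c *: ract x a.
Proof. by have := ract_linearr x c a 0; rewrite ract0r !addr0. Qed.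

Lemma ract0l X a : ract (0 : X) a = 0.
Proof. by have := ract_linearl a (-1) (0 : X) 0; rewrite !scaleN1r !addNr. Qed.

Lemma ractZl X (c : R[i]) a (x : X) : ract (c *: x) a = c *: ract x a.
Proof. by have := ract_linearl a c x 0; rewrite ract0l !addr0. Qed.

Lemma ractDl X a (x y : X) : ract (x + y) a = ract x a + ract y a.
Proof. by have := ract_linearl a 1 x y; rewrite !scale1r. Qed.

Lemma ract_continuous X a : continuous (fun x : X => ract x a).
Proof.
have [M M0 XM] := act_bounded X.
apply: (@linear_bound_continuous _ _ _ _ (M * `|a|)); rewrite ?mulr_ge0//.
- exact: ract_linearl.
- by move=> x; case: (XM a x).
Qed.

Definition ract_blin X a : blin X X :=
  Blin (@ract_linearl _ _ X a) (@ract_continuous X a).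

Lemma lact_continuous X a : continuous (fun x : X => lact a x).
Proof.
have [M M0 XM] := act_bounded X.
apply: (@linear_bound_continuous _ _ _ _ (M * `|a|)); rewrite ?mulr_ge0//.
- exact: lact_linearr.
- by move=> x; case: (XM a x).
Qed.

Definition lact_blin X a : blin X X :=
  Blin (@lact_linearr _ _ X a) (@lact_continuous X a).

(** Elements of [iter_dual A k.+1] are functionals only up to unfolding; naming the pairing fixes
    this view and keeps [k] visible to rewriting. *)
Definition pairing k (f : iter_dual A k.+1) (x : iter_dual A k) : R[i] :=
  (f : dual (iter_dual A k)) x.

Lemma pairing_ext k (f g : iter_dual A k.+1) : pairing f =1 pairing g -> f = g.
Proof. exact: dual_ext. Qed.

Lemma pairing_lact k a (f : iter_dual A k.+1) x :
  pairing (lact a f) x = pairing f (ract x a).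
Proof. by []. Qed.

Lemma pairing_ract k a (f : iter_dual A k.+1) x :
  pairing (ract f a) x = pairing f (lact a x).
Proof. by []. Qed.

Lemma pairingDl k (f g : iter_dual A k.+1) x :
  pairing (f + g) x = pairing f x + pairing g x.
Proof. by []. Qed.

Lemma pairingBl k (f g : iter_dual A k.+1) x :
  pairing (f - g) x = pairing f x - pairing g x.
Proof. by []. Qed.

Lemma pairingZl k (z : R[i]) (f : iter_dual A k.+1) x :
  pairing (z *: f) x = z * pairing f x.
Proof. by []. Qed.

Lemma pairing0l k x : pairing (0 : iter_dual A k.+1) x = 0.
Proof. by []. Qed.

Lemma pairingDr k (f : iter_dual A k.+1) x y :
  pairing f (x + y) = pairing f x + pairing f y.
Proof. exact: (raddfD (f : dual (iter_dual A k))). Qed.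

Lemma pairingBr k (f : iter_dual A k.+1) x y :
  pairing f (x - y) = pairing f x - pairing f y.
Proof. exact: (raddfB (f : dual (iter_dual A k))). Qed.

Lemma pairingZr k (z : R[i]) (f : iter_dual A k.+1) x :
  pairing f (z *: x) = z * pairing f x.
Proof. by rewrite /pairing linearZ. Qed.

Lemma pairing0r k (f : iter_dual A k.+1) : pairing f 0 = 0.
Proof. exact: (raddf0 (f : dual (iter_dual A k))). Qed.

(* The indices [m.*2] and [m.*2.+1] reduce along the recursion, so that no type cast
   is needed. *)
Fixpoint canon_emb (m : nat) : A -> iter_dual A m.*2 :=
  match m return A -> iter_dual A m.*2 with
  | 0 => id
  | m'.+1 => fun a => evaluation (canon_emb m' a)
  end.

Fixpoint canon_dual (m : nat) : iter_dual A 1 -> iter_dual A m.*2.+1 :=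
  match m return iter_dual A 1 -> iter_dual A m.*2.+1 with
  | 0 => id
  | m'.+1 => fun f => evaluation (canon_dual m' f)
  end.

Lemma pairing_canon_emb m a (f : iter_dual A m.*2.+1) :
  @pairing m.*2.+1 (canon_emb m.+1 a) f = pairing f (canon_emb m a).
Proof. by []. Qed.

Lemma pairing_canon_dualS m f (x : iter_dual A m.+1.*2) :
  @pairing m.+1.*2 (canon_dual m.+1 f) x = @pairing m.*2.+1 x (canon_dual m f).
Proof. by []. Qed.

Lemma canon_emb_lact m a b : canon_emb m (bmul a b) = lact a (canon_emb m b).
Proof. by elim: m => // m IHm; apply: dual_ext => f /=; rewrite IHm. Qed.

Lemma canon_emb_ract m a b : canon_emb m (bmul a b) = ract (canon_emb m a) b.
Proof. by elim: m => // m IHm; apply: dual_ext => f /=; rewrite IHm. Qed.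

(** Both embeddings step up by an evaluation, so the pairing changes sides twice and drops two
    levels. *)
Lemma pairing_canon_dual m (f : iter_dual A 1) (a : A) :
  pairing (canon_dual m f) (canon_emb m a) = pairing f a.
Proof. by elim: m. Qed.

Lemma canon_dualZ m (z : R[i]) f : canon_dual m (z *: f) = z *: canon_dual m f.
Proof.
elim: m => // m IHm; apply: (@pairing_ext m.+1.*2) => u.
by rewrite pairingZl !pairing_canon_dualS IHm (@pairingZr m.*2.+1).
Qed.

Lemma canon_dual0 m : canon_dual m 0 = 0.
Proof. by have := canon_dualZ m 0 0; rewrite !scale0r. Qed.

Lemma canon_dual_lact m a f : canon_dual m (lact a f) = lact a (canon_dual m f).
Proof.
elim: m => // m IHm; apply: (@pairing_ext m.+1.*2) => u.
by rewrite pairing_lact !pairing_canon_dualS IHm.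
Qed.

Lemma canon_dual_ract m a f : canon_dual m (ract f a) = ract (canon_dual m f) a.
Proof.
elim: m => // m IHm; apply: (@pairing_ext m.+1.*2) => u.
by rewrite pairing_ract !pairing_canon_dualS IHm.
Qed.

End bimodules.

(** * The iterated duals of the unitization *)

Section unitization_maps.
Variables (R : realType) (A : banachAlgType R[i]).
Local Notation B := (unitization A).
Implicit Types (a b c : A) (k m : nat).

Definition unit_in (a : A) : B := (a, 0).
Definition unit_proj (x : B) : A := x.1.
Definition unit_one : B := (0, 1).

Lemma unit_in_linear : linear unit_in.
Proof. by move=> z a b; congr pair; rewrite /= scaler0 addr0. Qed.

Lemma unit_in_continuous : continuous unit_in.
Proof.
apply: (@linear_bound_continuous _ _ _ _ 1) => //; first exact: unit_in_linear.
by move=> a; rewrite unitization_normE normr0 addr0 mul1r.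
Qed.

Definition unit_in_blin : blin A B := Blin unit_in_linear unit_in_continuous.

Lemma unit_proj_linear : linear unit_proj.
Proof. by []. Qed.

Lemma unit_proj_continuous : continuous unit_proj.
Proof.
apply: (@linear_bound_continuous _ _ _ _ 1) => // x.
by rewrite unitization_normE mul1r lerDl.
Qed.

Definition unit_proj_blin : blin B A := Blin unit_proj_linear unit_proj_continuous.

Lemma augmentation_subproof : (fun x : B => x.2) \in @dual_pred R B.
Proof.
apply: (@bounded_dual _ _ _ 1) => // x.
by rewrite unitization_normE mul1r lerDr.
Qed.

Definition augmentation : dual B := Dual augmentation_subproof.

Lemma unitization_eta (x : B) : x = unit_in x.1 + (x.2 : R[i]) *: unit_one.
Proof.
case: x => a z; congr pair => /=; first by rewrite scaler0 addr0.
by rewrite add0r -[RHS]/(z * 1) mulr1.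
Qed.

Lemma bmul_unit_in a b : bmul (unit_in a) (unit_in b) = unit_in (bmul a b).
Proof. by congr pair; rewrite /= ?scale0r ?addr0 ?mulr0. Qed.

Lemma bmul0l a : bmul 0 a = 0.
Proof. by have := bmul_linearl a (-1) 0 0; rewrite !scaleN1r !addNr. Qed.

Lemma bmul0r a : bmul a 0 = 0.
Proof. by have := bmul_linearr a (-1) 0 0; rewrite !scaleN1r !addNr. Qed.

Lemma bmul_unit_onel (x : B) : bmul unit_one x = x.
Proof.
case: x => a z; congr pair => /=; last exact: mul1r.
by rewrite bmul0l scaler0 scale1r !add0r.
Qed.

Lemma bmul_unit_oner (x : B) : bmul x unit_one = x.
Proof.
case: x => a z; congr pair => /=; last exact: mulr1.
by rewrite bmul0r scaler0 scale1r add0r addr0.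
Qed.

Lemma lract_unit_one k (x : iter_dual B k) :
  lact unit_one x = x /\ ract x unit_one = x.
Proof.
elim: k x => [|k IHk] x; first by split; [exact: bmul_unit_onel|exact: bmul_unit_oner].
by split; apply: pairing_ext => u;
  rewrite ?pairing_lact ?pairing_ract ?(IHk u).1 ?(IHk u).2.
Qed.

Lemma lact_unitE k (b : B) (x : iter_dual B k) :
  lact b x = lact (unit_in b.1) x + (b.2 : R[i]) *: x.
Proof. by rewrite {1}[b]unitization_eta lactDl lactZl (lract_unit_one x).1. Qed.

Lemma ract_unitE k (b : B) (x : iter_dual B k) :
  ract x b = ract x (unit_in b.1) + (b.2 : R[i]) *: x.
Proof. by rewrite {1}[b]unitization_eta ractDr ractZr (lract_unit_one x).2. Qed.

(** Transposition reverses arrows, so inclusion and projection must be built together. *)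
Fixpoint dual_maps k :
    blin (iter_dual A k) (iter_dual B k) * blin (iter_dual B k) (iter_dual A k) :=
  match k with
  | 0 => (unit_in_blin, unit_proj_blin)
  | k'.+1 => (adjoint (dual_maps k').2, adjoint (dual_maps k').1)
  end.

Definition dual_in k := (dual_maps k).1.
Definition dual_proj k := (dual_maps k).2.

Lemma pairing_in k (f : iter_dual A k.+1) x :
  pairing (dual_in k.+1 f) x = pairing f (dual_proj k x).
Proof. by []. Qed.

Lemma pairing_proj k (f : iter_dual B k.+1) x :
  pairing (dual_proj k.+1 f) x = pairing f (dual_in k x).
Proof. by []. Qed.

Lemma dual_inK k : cancel (dual_in k) (dual_proj k).
Proof.
elim: k => [//|k IHk] f; apply: pairing_ext => u.
by rewrite pairing_proj pairing_in IHk.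
Qed.

(** At level 0, the scalar part of an element of the unitization commutes with everything and drops
    out of commutators. Transposing a commutator map changes its sign and exchanges the two claims,
    hence the joint induction. *)
Lemma dual_ad k a :
  (forall x, dual_in k (lact a x - ract x a)
     = lact (unit_in a) (dual_in k x) - ract (dual_in k x) (unit_in a)) /\
  (forall x, dual_proj k (lact (unit_in a) x - ract x (unit_in a))
     = lact a (dual_proj k x) - ract (dual_proj k x) a).
Proof.
elim: k => [|k [IHi IHp]]; split.
- move=> x; congr pair => /=; last by rewrite mulr0 subrr.
  by rewrite !scale0r !addr0.
- by case=> x z; rewrite /= /unit_proj /= !scale0r !addr0 opprD addrACA subrr addr0.
- move=> f; apply: pairing_ext => u.
  rewrite pairing_in !pairingBl !pairing_lact !pairing_ract !pairing_in.
  by apply: oppr_inj; rewrite !opprB -!pairingBr -IHp raddfB.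
- move=> f; apply: pairing_ext => u.
  rewrite pairing_proj !pairingBl !pairing_lact !pairing_ract !pairing_proj.
  by apply: oppr_inj; rewrite !opprB -!pairingBr -IHi raddfB.
Qed.

(** The inclusion is multiplicative and stays a module map after two transpositions. The projection
    is in general not a module map at level 0, hence the restriction to even levels. *)
Lemma dual_in_hom m a (x : iter_dual A m.*2) :
  dual_in m.*2 (lact a x) = lact (unit_in a) (dual_in m.*2 x) /\
  dual_in m.*2 (ract x a) = ract (dual_in m.*2 x) (unit_in a).
Proof.
elim: m x => [|m IHm] x.
  by split; congr pair; rewrite /= ?scale0r ?addr0 ?mulr0.
by split; apply: (@pairing_ext _ _ m.*2.+1) => u;
  rewrite ?pairing_lact ?pairing_ract !(@pairing_in m.*2.+1)
    ?pairing_lact ?pairing_ract; congr pairing;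
  apply: pairing_ext => v; rewrite ?pairing_proj ?pairing_lact ?pairing_ract
    ?pairing_proj ?(IHm v).1 ?(IHm v).2.
Qed.

Lemma dual_proj_hom m a (x : iter_dual B m.*2.+1) :
  dual_proj m.*2.+1 (lact (unit_in a) x) = lact a (dual_proj m.*2.+1 x) /\
  dual_proj m.*2.+1 (ract x (unit_in a)) = ract (dual_proj m.*2.+1 x) a.
Proof.
by split; apply: pairing_ext => v; rewrite !pairing_proj ?pairing_lact
  ?pairing_ract pairing_proj ?(dual_in_hom a v).1 ?(dual_in_hom a v).2.
Qed.

(** The projection fails to be a module map only through scalar components, and at level 0 acting by
    [c] first puts [x] into [A]. Transposing twice carries the identity up. *)
Lemma dual_proj_ractA m a c (x : iter_dual B m.*2) :
  dual_proj m.*2 (ract (ract x (unit_in c)) (unit_in a))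
    = ract (dual_proj m.*2 (ract x (unit_in c))) a.
Proof.
elim: m x => [|m IHm] x.
  by case: x => b z; rewrite /= /unit_proj /= mulr0 !scale0r !addr0.
apply: (@pairing_ext _ _ m.*2.+1) => u.
rewrite pairing_ract !(@pairing_proj m.*2.+1) !pairing_ract; congr pairing.
apply: pairing_ext => v.
by rewrite !pairing_lact !pairing_in !pairing_lact IHm.
Qed.

Lemma lact_dual_inA m a c (x : iter_dual A m.*2.+1) :
  lact (unit_in c) (dual_in m.*2.+1 (lact a x))
    = lact (unit_in c) (lact (unit_in a) (dual_in m.*2.+1 x)).
Proof.
apply: pairing_ext => v.
by rewrite !pairing_lact !pairing_in !pairing_lact dual_proj_ractA.
Qed.

Definition unit_canon m : iter_dual B m.*2 := canon_emb m unit_one.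
Definition augmentation_canon m : iter_dual B m.*2.+1 := canon_dual m augmentation.

(** The identity and the character remain dual to each other: each reads off the coordinate along
    the other in [dual_split]. *)
Lemma pairing_augmentation_unit m :
  pairing (augmentation_canon m) (unit_canon m) = 1.
Proof. exact: pairing_canon_dual. Qed.

Lemma dual_split m :
  (forall x : iter_dual B m.*2, x = dual_in m.*2 (dual_proj m.*2 x)
    + pairing (augmentation_canon m) x *: unit_canon m) /\
  (forall f : iter_dual B m.*2.+1, f = dual_in m.*2.+1 (dual_proj m.*2.+1 f)
    + pairing f (unit_canon m) *: augmentation_canon m).
Proof.
(* Expanding the argument of [f] transposes the splitting to the next level; the passage from odd to
   even levels below is the same. *)
have even_odd m' : (forall x : iter_dual B m'.*2,
      x = dual_in m'.*2 (dual_proj m'.*2 x)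
        + pairing (augmentation_canon m') x *: unit_canon m') ->
    forall f : iter_dual B m'.*2.+1, f = dual_in m'.*2.+1 (dual_proj m'.*2.+1 f)
        + pairing f (unit_canon m') *: augmentation_canon m'.
  move=> split_even f; apply: pairing_ext => y; rewrite [in LHS](split_even y).
  by rewrite pairingDr pairingZr pairingDl pairingZl pairing_in pairing_proj mulrC.
suff split_even x : x = dual_in m.*2 (dual_proj m.*2 x)
    + pairing (augmentation_canon m) x *: unit_canon m.
  by split; [exact: split_even|exact/even_odd/split_even].
elim: m x => [|m /even_odd split_odd] x; first exact: unitization_eta.
apply: (@pairing_ext _ _ m.*2.+1) => f; rewrite [in LHS](split_odd f).
rewrite (@pairingDr _ _ m.*2.+1) (@pairingZr _ _ m.*2.+1).
rewrite (@pairingDl _ _ m.*2.+1) (@pairingZl _ _ m.*2.+1).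
by rewrite (@pairing_in m.*2.+1) (@pairing_proj m.*2.+1) mulrC.
Qed.

Lemma dual_in_canon_emb m a : dual_in m.*2 (canon_emb m a) = canon_emb m (unit_in a).
Proof.
elim: m => // m IHm; apply: (@pairing_ext _ _ m.*2.+1) => f.
by rewrite (@pairing_in m.*2.+1) !pairing_canon_emb pairing_proj IHm.
Qed.

Lemma dual_in_canon_dual m f :
  dual_in m.*2.+1 (canon_dual m f) = canon_dual m (dual_in 1 f).
Proof.
elim: m => // m IHm; apply: (@pairing_ext _ _ m.+1.*2) => x.
by rewrite pairing_in !pairing_canon_dualS (@pairing_proj m.*2.+1) IHm.
Qed.

(** The character vanishes on the ideal [A], so [A] acts by zero on it, at every odd level. *)
Lemma lact_augmentation m a : lact (unit_in a) (augmentation_canon m) = 0.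
Proof.
rewrite -canon_dual_lact -[RHS](canon_dual0 _ m); congr canon_dual.
by apply: dual_ext => x; exact: mulr0.
Qed.

Lemma ract_augmentation m a : ract (augmentation_canon m) (unit_in a) = 0.
Proof.
rewrite -canon_dual_ract -[RHS](canon_dual0 _ m); congr canon_dual.
by apply: dual_ext => x; exact: mul0r.
Qed.

End unitization_maps.

Arguments dual_in {R A} k.
Arguments dual_proj {R A} k.

(** * Approximately inner derivations *)

Lemma cvg_constant_eq (I : Type) (F : set_system I) (K : numFieldType)
    (V : normedModType K) (u : I -> V) (l l' : V) :
  ProperFilter F -> (forall i, u i = l) -> u @ F --> l' -> l' = l.
Proof.
move=> FF ul ul'; apply: (@cvg_unique _ (@norm_hausdorff _ V) _ _ _ _ ul').
by rewrite (funext ul : u = fun=> l); exact: cvg_cst.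
Qed.

Section approximately_inner_derivations.
Variables (R : realType) (C : banachAlgType R[i]).
Implicit Types (a b c : C) (k m : nat).

Lemma net_commutator_cvg (X : banach_bimodule C) (V : normedModType R[i])
    (T : blin X V) (D : C -> X) (I : Type) (le : I -> I -> Prop) (x : I -> X) a :
  directed le ->
  (fun i => lact a (x i) - ract (x i) a) @ net_tails le --> D a ->
  (fun i => T (lact a (x i) - ract (x i) a)) @ net_tails le --> T (D a).
Proof.
move=> le_dir Da; have tails_proper := net_tails_proper le_dir.
apply: cvg_comp Da _; exact: blin_continuous.
Qed.

(* [<b, a.x - x.a> + <a, b.x - x.b> = 0] for all [x]. *)
Lemma approximately_inner_cyclic m (D : C -> iter_dual C m.*2.+1) a b :
  approximately_inner D ->
  pairing (D a) (canon_emb m b) + pairing (D b) (canon_emb m a) = 0.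
Proof.
move=> [I [le [x [le_dir Dx]]]]; have tails_proper := net_tails_proper le_dir.
have ev_cvg u v := @cvg_comp _ _ _ _ _ _ _ _ (Dx u)
  (@dual_continuous _ _ (evaluation (canon_emb m v)) (D u)).
have sum_cvg := cvgD (ev_cvg a b) (ev_cvg b a).
apply: (@cvg_constant_eq _ _ _ R[i]^o _ 0 _ _ _ (sum_cvg _)) => i.
transitivity (pairing (lact a (x i) - ract (x i) a) (canon_emb m b)
  + pairing (lact b (x i) - ract (x i) b) (canon_emb m a)) => //.
rewrite !pairingBl !pairing_lact !pairing_ract -!canon_emb_lact -!canon_emb_ract.
by rewrite addrA subrK subrr.
Qed.

(** As [f] kills products, [a . f = f . a = 0], so [a |-> f(a) f] satisfies the derivation law with
    all terms 0. Being approximately inner, it yields [2 f(a)^2 = 0]. *)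
Lemma annihilator_square_eq0 m (f : iter_dual C 1) :
  approximately_k_weakly_amenable C m.*2.+1 ->
  (forall a b, pairing f (bmul a b : iter_dual C 0) = 0) -> f = 0.
Proof.
move=> wa f0; pose D := rank_one (f : dual C) (canon_dual m f).
have DE a : D a = pairing f (a : iter_dual C 0) *: canon_dual m f by [].
have Dder : derivation D.
  split; first exact: blin_linear.
  move=> a b; rewrite !DE f0 scale0r lactZr ractZl -canon_dual_lact -canon_dual_ract.
  rewrite (_ : lact a f = 0); last by apply: pairing_ext => u; exact: f0.
  rewrite (_ : ract f b = 0); last by apply: pairing_ext => u; exact: f0.
  by rewrite canon_dual0 !scaler0 addr0.
apply: pairing_ext => a.
have := approximately_inner_cyclic a a (wa D Dder (@blin_continuous _ _ _ D)).
rewrite !DE !pairingZl pairing_canon_dual -mulr2n => /eqP.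
by rewrite mulrn_eq0/= mulf_eq0 orbb => /eqP.
Qed.

Lemma derivation_eq0_approximately_inner (X : banach_bimodule C) (D : C -> X) :
  (forall a, D a = 0) -> approximately_inner D.
Proof.
move=> D0; exists unit, (fun _ _ => True), (fun=> 0); split.
  by split=> // _ _; exists tt.
move=> a; rewrite D0; under eq_fun do rewrite raddf0 ract0l subrr.
by move=> P /nbhs_singleton P0; exists tt.
Qed.

Section commutative.
Hypothesis C_comm : commutative (@bmul R[i] C).

Lemma lact_ract_comm k a (x : iter_dual C k) : lact a x = ract x a.
Proof.
elim: k x => [|k IHk] x; first exact: C_comm.
by apply: pairing_ext => u; rewrite pairing_lact -IHk.
Qed.

(** All commutators are 0, and so is their limit. With [derivation_eq0_approximately_inner],
    approximate [k]-weak amenability now says that every continuous derivation is 0. *)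
Lemma approximately_inner_eq0 k (D : C -> iter_dual C k) a :
  approximately_inner D -> D a = 0.
Proof.
move=> [I [le [x [le_dir Dx]]]]; have tails_proper := net_tails_proper le_dir.
by apply: (cvg_constant_eq _ _ (Dx a)) => i; rewrite lact_ract_comm subrr.
Qed.

End commutative.

End approximately_inner_derivations.

(** * Transfer of derivations between an algebra and its unitization *)

Section derivations_of_the_unitization.
Variables (R : realType) (A : banachAlgType R[i]).
Local Notation B := (unitization A).
Implicit Types (a b c : A) (k m : nat).

Lemma derivation_unit_one k (D : B -> iter_dual B k) (y : B) :
  derivation D -> D y = D (unit_in y.1).
Proof.
move=> [Dlin Dmul].
have D1 : D (unit_one A) = 0.
  (* [D e = D (e e) = D e + D e]. *)
  have := Dmul (unit_one A) (unit_one A).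
  rewrite bmul_unit_onel (lract_unit_one _).1 (lract_unit_one _).2.
  by move=> /eqP; rewrite -subr_eq0 opprD addrA subrr add0r oppr_eq0 => /eqP.
by rewrite [in LHS](unitization_eta y) -[unit_in _ + _]addrC Dlin D1 scaler0 add0r.
Qed.

(** Extending by 0 at [e] works because [e] acts as the identity map: scalar parts contribute the
    same multiples of [D] to both sides. *)
Lemma derivation_extension k (D : blin A (iter_dual B k)) :
  (forall a b, D (bmul a b) = lact (unit_in a) (D b) + ract (D a) (unit_in b)) ->
  derivation (blin_comp D (unit_proj_blin A)).
Proof.
move=> Dmul; split; first exact: blin_linear.
move=> x y; rewrite (lact_unitE x) (ract_unitE y).
transitivity (D (bmul x.1 y.1 + (y.2 : R[i]) *: x.1 + (x.2 : R[i]) *: y.1)) => //.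
rewrite !blinD !blinZ Dmul -!addrA; congr (_ + _).
by rewrite addrA addrC.
Qed.

(** Only commutators enter, so projecting the net works at levels of both parities. *)
Lemma approximately_inner_dual_proj k (D : B -> iter_dual B k) :
  approximately_inner D ->
  approximately_inner (fun a => dual_proj k (D (unit_in a))).
Proof.
move=> [I [le [x [le_dir Dx]]]]; exists I, le, (fun i => dual_proj k (x i)).
split=> // a.
rewrite [X in X @ _ --> _](_ : _ =
  fun i => dual_proj k (lact (unit_in a) (x i) - ract (x i) (unit_in a))).
  exact: net_commutator_cvg (Dx (unit_in a)).
by apply/funext => i; rewrite (dual_ad k a).2.
Qed.

Lemma approximately_inner_dual_in k (D : A -> iter_dual A k) :
  approximately_inner D ->
  approximately_inner (fun b : B => dual_in k (D b.1)).
Proof.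
move=> [I [le [x [le_dir Dx]]]]; exists I, le, (fun i => dual_in k (x i)).
split=> // b.
rewrite [X in X @ _ --> _](_ : _ =
  fun i => dual_in k (lact b.1 (x i) - ract (x i) b.1)).
  exact: net_commutator_cvg (Dx b.1).
(* The scalar part of [b] acts alike on both sides and cancels. *)
apply/funext => i; rewrite (dual_ad k b.1).1 (lact_unitE b) (ract_unitE b).
by rewrite opprD addrACA subrr addr0.
Qed.

(** At even levels [dual_in] is a module map, so [D] composed with it extends to the unitization;
    projecting the resulting net back recovers [D]. *)
Lemma even_weakly_amenable_of_unitization m :
  approximately_k_weakly_amenable B m.*2 ->
  approximately_k_weakly_amenable A m.*2.
Proof.
move=> waB D [Dlin Dmul] Dcont.
pose E := blin_comp (dual_in m.*2) (Blin Dlin Dcont).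
have Eder : derivation (blin_comp E (unit_proj_blin A)).
  apply: derivation_extension => a b.
  by rewrite /E /= Dmul blinD (dual_in_hom a _).1 (dual_in_hom b _).2.
have := approximately_inner_dual_proj (waB _ Eder (@blin_continuous _ _ _ _)).
congr approximately_inner; apply/funext => a /=; exact: dual_inK.
Qed.

(* A derivation [D] of the unitization into an odd dual has a component
   [a |-> <e, D a>] besides its restriction to [A]; it vanishes on products. *)
Lemma odd_weakly_amenable_unitization m :
  approximately_k_weakly_amenable A m.*2.+1 ->
  approximately_k_weakly_amenable B m.*2.+1.
Proof.
move=> waA D Dder Dcont; have [Dlin Dmul] := Dder.
pose E := blin_comp (Blin Dlin Dcont) (unit_in_blin A).
pose D1 := blin_comp (dual_proj m.*2.+1) E.
have D1E a : D1 a = dual_proj m.*2.+1 (D (unit_in a)) by [].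
have D1der : derivation D1.
  split; first exact: blin_linear.
  move=> a b; rewrite !D1E -bmul_unit_in Dmul blinD.
  by rewrite (dual_proj_hom a _).1 (dual_proj_hom b _).2.
have D1inner := waA _ D1der (@blin_continuous _ _ _ _).
pose d : iter_dual A 1 := dual_comp E (evaluation (unit_canon A m)).
(* On a product, [<e, D (ab)> = <a, D b> + <b, D a>], which is 0 because [D1] is approximately
   inner. *)
have d0 : d = 0.
  apply: (annihilator_square_eq0 waA) => a b.
  rewrite -(approximately_inner_cyclic b a D1inner) !D1E !pairing_proj !dual_in_canon_emb.
  transitivity (pairing (D (unit_in (bmul a b))) (unit_canon A m)) => //.
  rewrite -bmul_unit_in Dmul pairingDl pairing_lact pairing_ract /unit_canon.
  by rewrite -canon_emb_lact -canon_emb_ract bmul_unit_onel bmul_unit_oner.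
(* Without its scalar component, [D] is [D1] followed by [dual_in], so the net of [D1] lifts. *)
have := approximately_inner_dual_in D1inner.
congr approximately_inner; apply/funext => b.
rewrite (derivation_unit_one b Dder) [RHS](dual_split A m).2.
have -> : pairing (D (unit_in b.1)) (unit_canon A m) = pairing d b.1 by [].
by rewrite d0 pairing0l scale0r addr0.
Qed.

End derivations_of_the_unitization.

(** * The commutative case *)

Section commutative.
Variables (R : realType) (A : banachAlgType R[i]).
Hypothesis A_comm : commutative (@bmul R[i] A).
Local Notation B := (unitization A).
Implicit Types (a b c : A) (m : nat).

Lemma unitization_commutative : commutative (@bmul R[i] B).
Proof.
move=> x y; congr pair; last exact: mulrC.
by rewrite A_comm -!addrA; congr (_ + _); exact: addrC.
Qed.

Let lractA_comm k a (x : iter_dual A k) : lact a x = ract x a.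
Proof. exact: lact_ract_comm. Qed.

Let lractB_comm k (b : B) (x : iter_dual B k) : lact b x = ract x b.
Proof. by apply: lact_ract_comm; exact: unitization_commutative. Qed.

Let ract_ractC k a b (x : iter_dual B k) :
  ract (ract x (unit_in a)) (unit_in b) = ract (ract x (unit_in b)) (unit_in a).
Proof. by rewrite -!ractM unitization_commutative. Qed.

(** At [(x, z)] the left side is [f(xa + za) = z f(a)]. Although [a . f = 0] over [A], a multiple of
    the character survives over the unitization; this makes [d] visible below. *)
Lemma lact_dual_in_annihilator (f : iter_dual A 1) a :
  (forall x y : A, pairing f (bmul x y : iter_dual A 0) = 0) ->
  lact (unit_in a) (dual_in 1 f)
    = pairing f (a : iter_dual A 0) *: (augmentation A : iter_dual B 1).
Proof.
move=> f0; apply: pairing_ext => -[x z].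
rewrite pairing_lact pairing_in pairingZl.
transitivity
  (pairing f (bmul x a + (0 : R[i]) *: x + (z : R[i]) *: a : iter_dual A 0)) => //.
by rewrite (@pairingDr _ _ 0) pairingZr scale0r addr0 f0 add0r mulrC.
Qed.

(* For [D a = D1 a + d a *: e], each [a |-> c . D a] is a derivation with values in
   [A^(2m+2)], hence [0]; pairing it with [d] gives [d a * d c = 0]. *)
Lemma even_weakly_amenable_unitization m :
  approximately_k_weakly_amenable A m.+1.*2 ->
  approximately_k_weakly_amenable B m.+1.*2.
Proof.
move=> waA D Dder Dcont; have [Dlin Dmul] := Dder.
apply: derivation_eq0_approximately_inner => y.
rewrite (derivation_unit_one y Dder); move: y.1 => {y}.
pose E := blin_comp (Blin Dlin Dcont) (unit_in_blin A).
have Emul a b : E (bmul a b) = ract (E b) (unit_in a) + ract (E a) (unit_in b).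
  by rewrite -lractB_comm -Dmul bmul_unit_in.
suff E0 a : E a = 0 by [].
pose F c := blin_comp (dual_proj m.+1.*2) (blin_comp (ract_blin _ (unit_in c)) E).
have FE c b : F c b = dual_proj m.+1.*2 (ract (E b) (unit_in c)) by [].
(* Acting by [c] before projecting makes [F c] a derivation, by [dual_proj_ractA]. *)
have F0 c b : F c b = 0.
  apply: (approximately_inner_eq0 A_comm); apply: waA; last exact: blin_continuous.
  split; first exact: blin_linear.
  move=> x y; rewrite !FE Emul ractDl blinD !(ract_ractC _ c) lractA_comm.
  by rewrite -!dual_proj_ractA.
pose d : iter_dual A 1 := dual_comp E (evaluation (augmentation_canon A m)).
have dE b : pairing d (b : iter_dual A 0)
  = @pairing _ _ m.*2.+1 (E b) (augmentation_canon A m) by [].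
(* [A] acts by zero on the character, so both terms of the derivation law pair to 0 with it. *)
have d_mul x y : pairing d (bmul x y : iter_dual A 0) = 0.
  rewrite dE Emul (@pairingDl _ _ m.*2.+1) !(@pairing_ract _ _ m.*2.+1).
  by rewrite !lact_augmentation !(@pairing0r _ _ m.*2.+1) addr0.
have d0 b : pairing d (b : iter_dual A 0) = 0.
  have := @pairing0l _ A m.*2.+1 (canon_dual m d); rewrite -(F0 b b) FE.
  rewrite (@pairing_proj _ _ m.*2.+1) (@pairing_ract _ _ m.*2.+1).
  rewrite dual_in_canon_dual -canon_dual_lact lact_dual_in_annihilator//.
  rewrite canon_dualZ (@pairingZr _ _ m.*2.+1) -dE => /eqP.
  by rewrite mulf_eq0 orbb => /eqP.
(* Now [E] takes values in the range of [dual_in], an injective module map at even levels, so the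
   derivation law descends to [D1]. *)
pose D1 := blin_comp (dual_proj m.+1.*2) E.
have ED1 b : E b = dual_in m.+1.*2 (D1 b).
  rewrite [LHS](dual_split A m.+1).1 [X in X *: _](_ : _ = 0) ?scale0r ?addr0//.
  by rewrite [LHS]pairing_canon_dualS -dE d0.
rewrite ED1 [D1 a](approximately_inner_eq0 A_comm) ?raddf0//.
apply: waA; last exact: blin_continuous.
split; first exact: blin_linear.
move=> x y; apply: (can_inj (@dual_inK _ _ m.+1.*2)).
rewrite -ED1 Emul lractA_comm blinD.
by rewrite (dual_in_hom (m := m.+1) x _).2 (dual_in_hom (m := m.+1) y _).2 -!ED1.
Qed.

(** At odd levels [dual_in] need not be a module map, so [D] itself may not extend. The maps [c . D]
    do extend, by [lact_dual_inA], and hence vanish; then [D] kills products, and so does each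
    functional [<u, D a>]. *)
Lemma odd_weakly_amenable_of_unitization m :
  approximately_k_weakly_amenable B m.*2.+1 ->
  approximately_k_weakly_amenable A m.*2.+1.
Proof.
move=> waB D [Dlin Dmul] Dcont.
apply: derivation_eq0_approximately_inner => a.
pose E := Blin Dlin Dcont.
have ext0 (F : blin A (iter_dual B m.*2.+1)) b :
    (forall x y, F (bmul x y) = lact (unit_in x) (F y) + ract (F x) (unit_in y)) ->
    F b = 0.
  move=> Fmul; apply: (approximately_inner_eq0 unitization_commutative
    (D := blin_comp F (unit_proj_blin A)) (unit_in b)).
  by apply: waB; [exact: derivation_extension|exact: blin_continuous].
pose F c := blin_comp (blin_comp (lact_blin _ (unit_in c)) (dual_in m.*2.+1)) E.
have FE c b : F c b = lact (unit_in c) (dual_in m.*2.+1 (D b)) by [].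
have D_lact c b : lact c (D b) = 0.
  rewrite -[D b](@dual_inK _ _ m.*2.+1) -(dual_proj_hom c _).1 -FE ext0 ?raddf0//.
  move=> x y; rewrite !FE Dmul -lractA_comm blinD lactDr !lact_dual_inA.
  by rewrite -[in RHS]lractB_comm -!lactM ![bmul (unit_in c) _]unitization_commutative.
have D_mul x y : D (bmul x y) = 0 by rewrite Dmul -lractA_comm !D_lact addr0.
apply: pairing_ext => u; rewrite pairing0l.
pose f : iter_dual A 1 := dual_comp E (evaluation u).
(* A functional killing products times the character, on which [A] acts by zero, is a derivation;
   pairing with the identity recovers the functional. *)
pose G := rank_one (f : dual A) (augmentation_canon A m).
have GE b : G b = pairing (D b) u *: augmentation_canon A m by [].
have := @pairing0l _ B _ (unit_canon A m); rewrite -(ext0 G a).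
  by rewrite GE pairingZl pairing_augmentation_unit mulr1.
move=> x y; rewrite !GE D_mul pairing0l scale0r lactZr ractZl.
by rewrite lact_augmentation ract_augmentation !scaler0 addr0.
Qed.

End commutative.

(** * Bounded approximate identities *)

Section bounded_approximate_identity.
Variables (R : realType) (A : banachAlgType R[i]).
Local Notation B := (unitization A).
Implicit Types a b : A.

(* On a product, [<e_i, D (ab)> = <e_i a, D b> + <b e_i, D a>] converges; products
   are dense, and the functionals [a |-> <e_i, D a>] are uniformly bounded. *)
Lemma bounded_approximate_identity_functional (D : A -> iter_dual A 1) :
  has_bounded_approximate_identity A -> derivation D -> continuous D ->
  exists f : dual A, forall a b,
    f (bmul a b) = pairing (D b) (a : iter_dual A 0) + pairing (D a) (b : iter_dual A 0).
Proof.
move=> [I [le [e [le_dir [M eM] e_id]]]] [Dlin Dmul] Dcont.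
have FF := net_tails_proper le_dir; set F := net_tails le in FF e_id.
pose E := Blin Dlin Dcont; have [N N0 EN] := blin_bounded E.
have M0 : 0 <= M by have [[j] _ _ _] := le_dir; exact: le_trans (normr_ge0 _) (eM j).
pose g a i : R[i]^o := pairing (D a) (e i : iter_dual A 0).
have g_linear i : linear (fun a => g a i).
  by move=> z a b; rewrite /g Dlin pairingDl pairingZl.
have g_le a i : `|g a i| <= N * M * `|a|.
  rewrite (le_trans (dual_leP (D a : dual A) (e i)))// mulrAC.
  by apply: ler_pM => //; [exact: EN|exact: eM].
have g_mul a b : g (bmul a b) @ F -->
    (pairing (D b) (a : iter_dual A 0) + pairing (D a) (b : iter_dual A 0) : R[i]^o).
  have -> : g (bmul a b) =
      fun i => (D b : dual A) (bmul (e i) a) + (D a : dual A) (bmul b (e i)).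
    by apply/funext => i; rewrite /g Dmul.
  apply: cvgD; first exact:
    (cvg_comp _ _ (e_id a).1 (@dual_continuous _ _ (D b : dual A) a)).
  exact: (cvg_comp _ _ (e_id b).2 (@dual_continuous _ _ (D a : dual A) b)).
(* Approximate [a] by [a e_k]: the net converges at this product, and the error is at most
   [N M |a - a e_k|]. The [+ 1] in the bound avoids dividing by 0. *)
have g_cvg a : exists l : R[i]^o, g a @ F --> l.
  apply/cvg_ex; apply: complex_complete; apply/cauchyP => r r0.
  have r20 : 0 < r / 2 by rewrite divr_gt0.
  have d0 : 0 < r / 2 / (N * M + 1) by rewrite divr_gt0// ltr_wpDl// mulr_ge0.
  have [k ak] : exists k, `|a - bmul a (e k)| <= r / 2 / (N * M + 1).
    have /cvgrPdist_le/(_ _ d0) := (e_id a).2.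
    by move=> /filter_ex.
  exists (pairing (D (e k)) (a : iter_dual A 0) + pairing (D a) (e k : iter_dual A 0)).
  have /cvgrPdist_lt/(_ _ r20) := g_mul a (e k).
  rewrite /fmap/=; apply: filterS => i gi; rewrite -ball_normE /=.
  rewrite (le_lt_trans (ler_distD (g (bmul a (e k)) i) _ _))// [ltRHS]splitr.
  rewrite ltr_leD// distrC.
  have -> : g a i - g (bmul a (e k)) i = g (a - bmul a (e k)) i.
    have := g_linear i (-1) (bmul a (e k)) a; rewrite !scaleN1r.
    by rewrite [in LHS]addrC => ->; rewrite addrC.
  rewrite (le_trans (g_le _ _))// (@le_trans _ _ ((N * M + 1) * `|a - bmul a (e k)|))//.
    by rewrite ler_wpM2r// lerDl.
  by rewrite -ler_pdivlMl ?ltr_wpDl ?mulr_ge0// mulrC.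
pose l a := projT1 (cid (g_cvg a)).
have lP a : g a @ F --> l a by rewrite /l; case: cid.
have l_unique a z : g a @ F --> (z : R[i]^o) -> l a = z.
  by apply: (@cvg_unique _ (@norm_hausdorff _ R[i]^o) _ _ _ _ (lP a)).
have l_lin : linear l.
  move=> z a b; apply: l_unique.
  have -> : g (z *: a + b) = fun i => z *: g a i + g b i.
    by apply/funext => i; exact: g_linear.
  by apply: cvgD; [apply: cvgZr; exact: lP|exact: lP].
have l_dual : l \in @dual_pred R A.
  apply: (@bounded_dual _ _ _ (N * M)) => //; first exact: mulr_ge0.
  move=> a; apply/ler_addgt0Pr => r r0.
  have /cvgrPdist_le/(_ _ r0)/filter_ex[i li] := lP a.
  rewrite -[l a](subrK (g a i)) addrC (le_trans (ler_normD _ _))// lerD//.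
by exists (Dual l_dual) => a b; exact: l_unique.
Qed.

(** The defect of [dual_in] as a module map shows at the identity, where the derivation law requires
    the value [<a, D b> + <b, D a>] on [ab]. Adding [f] times the character supplies it. *)
Lemma weakly_amenable_of_unitization :
  has_bounded_approximate_identity A ->
  approximately_k_weakly_amenable B 1 -> approximately_k_weakly_amenable A 1.
Proof.
move=> bai waB D Dder Dcont; have [Dlin Dmul] := Dder.
have [f fmul] := bounded_approximate_identity_functional bai Dder Dcont.
pose aug : iter_dual B 1 := augmentation A.
pose S := blin_comp (dual_in 1) (Blin Dlin Dcont).
pose T := rank_one f aug.
pose g a := S a + T a.
have glin : linear g by move=> z a b; rewrite /g !linearP/= scalerDr addrACA.
have gcont : continuous g.
  by move=> a; apply: cvgD; exact: blin_continuous.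
pose G := Blin glin gcont.
have GE a : G a = dual_in 1 (D a) + (f a : R[i]) *: aug by [].
have Gder : derivation (blin_comp G (unit_proj_blin A)).
  apply: derivation_extension => a b; rewrite !GE.
  apply: pairing_ext => -[x z].
  rewrite !pairingDl pairing_lact pairing_ract !pairingDl !pairingZl !pairing_in.
  rewrite fmul Dmul pairingDl pairing_lact pairing_ract.
  transitivity (pairing (D b) (bmul x a + (0 : R[i]) *: x + (z : R[i]) *: a : iter_dual A 0)
    + f b * (z * 0)
    + (pairing (D a) (bmul b x + (z : R[i]) *: b + (0 : R[i]) *: x : iter_dual A 0)
    + f a * (0 * z))) => //.
  rewrite !(@pairingDr _ _ 0) !(@pairingZr _ _ 0).
  by rewrite !(mulr0, mul0r, addr0) mulrDl ![_ * z]mulrC addrACA.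
have := approximately_inner_dual_proj (waB _ Gder (@blin_continuous _ _ _ _)).
congr approximately_inner; apply/funext => a; apply: pairing_ext => x.
rewrite pairing_proj.
transitivity (pairing (G a) (dual_in 0 x)) => //.
(* The character vanishes on [A], so projecting removes the correction and returns [D]. *)
by rewrite GE pairingDl pairing_in dual_inK pairingZl
  [pairing aug _]/(0 : R[i]) mulr0 addr0.
Qed.

End bounded_approximate_identity.

Theorem proposition3p3 (R : realType) (A : banachAlgType R[i]) (n : nat)
    (A_nonunital : ~ has_identity A) (n_gt0 : (0 < n)%N) :
  [/\ approximately_k_weakly_amenable (unitization A) (2 * n)%N ->
      approximately_k_weakly_amenable A (2 * n)%N,
      approximately_k_weakly_amenable A (2 * n - 1)%N ->
      approximately_k_weakly_amenable (unitization A) (2 * n - 1)%N,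
      commutative (@bmul R[i] A) ->
      (approximately_k_weakly_amenable (unitization A) n <->
       approximately_k_weakly_amenable A n) &
      has_bounded_approximate_identity A ->
      (approximately_weakly_amenable A <->
       approximately_weakly_amenable (unitization A))].
Proof.
split.
- by rewrite mul2n; exact: even_weakly_amenable_of_unitization.
- case: n n_gt0 => // m _; rewrite mul2n doubleS subn1.
  exact: odd_weakly_amenable_unitization.
- move=> A_comm; rewrite -(odd_double_half n); case: (boolP (odd n)) => [_|n_even].
    split; first exact: odd_weakly_amenable_of_unitization.
    exact: odd_weakly_amenable_unitization.
  rewrite add0n; split; first exact: even_weakly_amenable_of_unitization.
  (* For even [n], positivity excludes level 0, as the shifted index [m.+1] requires. *)
  have : (0 < n./2)%N by rewrite half_gt0; case: n n_gt0 n_even => [|[]].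
  by case: n./2 => // m _; exact: even_weakly_amenable_unitization.
- move=> bai; split; first exact: (@odd_weakly_amenable_unitization _ _ 0).
  exact: weakly_amenable_of_unitization.
Qed.
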